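(* Let $\mathcal{L}_e$ be a set of $L_e$ existing lines on the nodes $\{0,1,\dots,N\}$ with known positive resistances, and let $\mathbf{b}_o\in\{0,1\}^{L_e}$ be the true line status vector, whose energized lines form a tree on $\{0,\dots,N\}$ rooted at $0$. Let $\mathcal{C}\subseteq\{1,\dots,N\}$ with $C:=|\mathcal{C}|$ be the set of probed buses, let $\mathbf{\Delta}\in\mathbb{R}^{C\times T}$ satisfy $\mathrm{rank}(\mathbf{\Delta})=C$, and let $\tilde{\mathbf{V}}=\mathbf{R}(\mathbf{b}_o)\mathbf{I}_{\mathcal{C}}\mathbf{\Delta}$. If the grid is probed at all leaf nodes, that is $\mathcal{F}(\mathbf{b}_o)\subseteq\mathcal{C}$, then the grid topology is verifiable, i.e. $\mathbf{b}_o$ is the unique minimizer of the problem $$\min_{\mathbf{b}}\ \|\mathbf{\Theta}(\mathbf{b})\tilde{\mathbf{V}}-\mathbf{I}_{\mathcal{C}}\mathbf{\Delta}\|_{\mathbf{W}}^2\quad\text{subject to}\quad \mathbf{b}\in\{0,1\}^{L_e},\ \ \mathbf{1}^\top\mathbf{b}=N,\ \ \mathbf{\Theta}(\mathbf{b})\succ\mathbf{0}.$$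
   Context: The existing lines $\mathcal{L}_e$ are the edges of a simple undirected graph on $\{0,\dots,N\}$ (no loops or parallel lines). A line status vector $\mathbf{b}\in\{0,1\}^{L_e}$ has $b_\ell=1$ if line $\ell\in\mathcal{L}_e$ is energized and $b_\ell=0$ otherwise. Let $\mathbf{A}$ be the $L_e\times N$ reduced branch-bus incidence matrix of all lines in $\mathcal{L}_e$ (the row of a line has $+1$ and $-1$ at its two end nodes and zeros elsewhere, with the column of node $0$ removed), and $\mathbf{r}$ the vector of positive line resistances. Then $\mathbf{\Theta}(\mathbf{b}):=\mathbf{A}^\top\mathrm{diag}(\mathbf{b})\,\mathrm{diag}(\mathbf{r})^{-1}\mathbf{A}$ and, when it is nonsingular, $\mathbf{R}(\mathbf{b}):=\mathbf{\Theta}(\mathbf{b})^{-1}$. The constraints of the problem hold exactly when the energized lines form a tree on $\{0,\dots,N\}$. $\mathcal{F}(\mathbf{b})$ is the set of leaves of the tree of energized lines rooted at $0$: nodes having no descendants other than themselves, where $m$ is a descendant of $n$ if $n$ lies on the path from $0$ to $m$. $\mathbf{I}_{\mathcal{C}}$ is the $N\times C$ matrix whose columns are the canonical vectors $\mathbf{e}_m\in\mathbb{R}^N$, $m\in\mathcal{C}$. $\mathbf{W}\succ\mathbf{0}$ is a fixed $N\times N$ matrix and $\|\mathbf{X}\|_{\mathbf{W}}^2:=\mathrm{Tr}(\mathbf{X}^\top\mathbf{W}\mathbf{X})$. *)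

(* Defs.v *)
From HB Require Import structures.
From mathcomp Require Import all_boot all_order all_algebra.

Set Implicit Arguments.
Unset Strict Implicit.
Unset Printing Implicit Defensive.

Import Order.TTheory GRing.Theory Num.Theory.
Local Open Scope ring_scope.

(* L lines on the nodes {0, ..., N}: the edges of a simple undirected graph,
   each listed once.  The orientation from -> to is arbitrary and only fixes
   the signs of the incidence matrix. *)
Record lines (N L : nat) := Lines {
  from : 'I_L -> 'I_N.+1;
  to : 'I_L -> 'I_N.+1;
  no_loop : forall l, from l != to l;
  no_parallel : injective (fun l => [set from l; to l])
}.

Definition status (L : nat) := {ffun 'I_L -> bool}.

Definition adj (N L : nat) (E : lines N L) (b : status L) : rel 'I_N.+1 :=
  [rel x y | [exists l, b l && ([set from E l; to E l] == [set x; y])]].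

(* [adj] is symmetric, so a repetition-free cyclic sequence of length 2 only
   goes back and forth along one line; cycles have at least three nodes. *)
Definition is_tree (N L : nat) (E : lines N L) (b : status L) : Prop :=
  (forall x y, connect (adj E b) x y) /\
  (forall c : seq 'I_N.+1, (2 < size c)%N -> ~ ucycle (adj E b) c).

(* m is a descendant of n: n lies on the (simple) path from the root 0 to m. *)
Definition descendant (N L : nat) (E : lines N L) (b : status L)
    (n m : 'I_N.+1) : Prop :=
  exists p : seq 'I_N.+1,
    [/\ path (adj E b) ord0 p, uniq (ord0 :: p), last ord0 p = m
      & n \in ord0 :: p].

Definition leaf (N L : nat) (E : lines N L) (b : status L)
    (n : 'I_N.+1) : Prop :=
  forall m, descendant E b n m -> m = n.

(* The non-root node n + 1 is [lift ord0 n] for n : 'I_N; it indexes column n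
   of the reduced incidence matrix. *)
Definition incidence (R : realFieldType) (N L : nat) (E : lines N L) :
    'M[R]_(L, N) :=
  \matrix_(l, n) ((from E l == lift ord0 n)%:R - (to E l == lift ord0 n)%:R).

Definition Theta (R : realFieldType) (N L : nat) (E : lines N L)
    (r : 'rV[R]_L) (b : status L) : 'M[R]_N :=
  (incidence R E)^T *m diag_mx (\row_l (b l)%:R) *m invmx (diag_mx r)
    *m incidence R E.

(* Meaningful when [Theta E r b] is nonsingular. *)
Definition Rmx (R : realFieldType) (N L : nat) (E : lines N L)
    (r : 'rV[R]_L) (b : status L) : 'M[R]_N :=
  invmx (Theta E r b).

(* The columns of I_C are the canonical vectors e_m, m in C, in the order of
   the enumeration of C. *)
Definition selmx (R : realFieldType) (N : nat) (C : {set 'I_N}) :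
    'M[R]_(N, #|C|) :=
  \matrix_(n, j) (n == enum_val j)%:R.

Definition posdef (R : realFieldType) (n : nat) (M : 'M[R]_n) : Prop :=
  M^T = M /\ forall x : 'cV[R]_n, x != 0 -> 0 < (x^T *m M *m x) 0 0.

Definition sqnorm (R : realFieldType) (m n : nat) (W : 'M[R]_m)
    (X : 'M[R]_(m, n)) : R :=
  \tr (X^T *m W *m X).

Definition feasible (R : realFieldType) (N L : nat) (E : lines N L)
    (r : 'rV[R]_L) (b : status L) : Prop :=
  (\sum_l b l)%N = N /\ posdef (Theta E r b).

Definition objective (R : realFieldType) (N L T : nat) (E : lines N L)
    (r : 'rV[R]_L) (W : 'M[R]_N) (C : {set 'I_N}) (Delta : 'M[R]_(#|C|, T))
    (V : 'M[R]_(N, T)) (b : status L) : R :=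
  sqnorm W (Theta E r b *m V - selmx R C *m Delta).

Definition minimizer (R : realFieldType) (N L T : nat) (E : lines N L)
    (r : 'rV[R]_L) (W : 'M[R]_N) (C : {set 'I_N}) (Delta : 'M[R]_(#|C|, T))
    (V : 'M[R]_(N, T)) (b : status L) : Prop :=
  feasible E r b /\
  forall b', feasible E r b' ->
    objective E r W Delta V b <= objective E r W Delta V b'.

(* Main.v *)
Require Import Defs.
From mathcomp Require Import all_boot all_order all_algebra.

Set Implicit Arguments.
Unset Strict Implicit.
Unset Printing Implicit Defensive.

Import Order.TTheory GRing.Theory Num.Theory.
Local Open Scope ring_scope.

(** The objective vanishes at the true status [bo], so a minimizer [b] satisfies
    [Theta b *m (Rmx bo *m e_m) = e_m] for every probed [m], by positivity of
    [W] and full row rank of [Delta]. In words: the node potential that drives a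
    unit current from [m] to the root through the tree of [bo] also does so
    through the lines of [b]. It has to be shown that this forces [b = bo].

    Write D_x for the set of descendants of a non-root node x in the tree of
    [bo]. The fundamental cuts D_x diagonalize the Laplacian of the tree
    ([cutmx_Theta]), so the potential for [m] is the sum, over the ancestors x
    of [m], of the resistance above x times the indicator of D_x. When [m] is in
    D_x it is therefore strictly higher in D_x than outside ([tree_downhill]).

    On the side of [b], having N lines and a positive definite Laplacian has two
    consequences. Every nonempty set without the root is left by a line of [b]
    ([posdef_cut]), and the flow driven by a unit injection is 0, 1 or -1 on
    each line ([unit_flow]): it is read off from the potential whose drop is 1
    along that line and 0 along the others, and the level sets of this potential
    must be left by that line.

    Every D_x contains a leaf, which is probed. The flow of its potential
    through [b] leaves D_x with total 1, in whole positive units, so exactly one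
    line of [b] leaves D_x ([downhill_cut_unique]). If D_x and D_y shared that
    line, no line of [b] would leave their symmetric difference, so x = y
    ([shared_cut]). The ends of a line of [b] are thus separated by at most one
    D_x, which makes them adjacent in the tree ([edge_of_cuts]). Conversely, the
    only tree line leaving D_x is the one above x, so it belongs to [b]. *)

(** * Rooted trees and their descendant sets *)

(** Past their last common node [x], two distinct paths leave along different
    neighbors [a] and [b] of [x] and meet again without [x], so [a] and [b] are
    joined by a path that avoids [x]; it closes up at [x] into a cycle. *)
Lemma acyclic_path_unique (T : finType) (e : rel T) :
    symmetric e ->
    (forall c : seq T, (2 < size c)%N -> ~ ucycle e c) ->
  forall x p q, path e x p -> path e x q -> uniq (x :: p) -> uniq (x :: q) ->
  last x p = last x q -> p = q.
Proof.
move=> e_sym acyc x p; elim: p x => [|a p IHp] x [|b q] //.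
- by move=> _ _ _ /andP[xNq _] /= eq_x; rewrite eq_x mem_last in xNq.
- by move=> _ _ /andP[xNp _] _ /= eq_x; rewrite -eq_x mem_last in xNp.
move=> /= /andP[exa ep] /andP[exb eq] /andP[xNp up] /andP[xNq uq] eq_last.
have [ab | aNb] := eqVneq a b.
  by rewrite -ab in eq uq eq_last *; rewrite (IHp a q).
(* [e] with the node [x] deleted *)
pose e' := [rel u v | [&& e u v, u != x & v != x]].
have e'_sym : connect_sym e'.
  by apply: sym_connect_sym => u v /=; rewrite e_sym andbCA andbC -andbA andbCA.
have lift_path c s : path e c s -> x \notin c :: s -> connect e' c (last c s).
  move=> es xNs; apply/connectP; exists s => //.
  elim: s c es xNs => //= d s IHs c /andP[ecd es].
  rewrite !inE !negb_or => /and3P[xc xd xs].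
  by rewrite ecd eq_sym xc eq_sym xd IHs // inE negb_or xd.
have: connect e' a b.
  rewrite (connect_trans (lift_path _ _ ep xNp)) // eq_last e'_sym.
  exact: lift_path.
case/connectP=> s0 /shortenP[s es us _] b_def.
case: (acyc [:: x, a & s]).
  by case: s b_def {es us} => //= ba; rewrite ba eqxx in aNb.
rewrite /ucycle /= rcons_path -b_def exa [e b x]e_sym exb andbT /=.
have ax : a != x by apply: contraNneq xNp => ->; rewrite mem_head.
have [es' xNs] : path e a s /\ x \notin s.
  elim: s a es {us b_def ep eq up IHp xNp aNb exa eq_last lift_path} ax
    => //= c s IHs a /andP[/and3P[eac _ cx] es] ax.
  by have [-> xs] := IHs c es cx; rewrite eac inE negb_or eq_sym cx.
by rewrite es' inE negb_or eq_sym ax xNs.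
Qed.

Section RootedTree.

Variables (T : finType) (e : rel T) (o : T).
Hypotheses (e_sym : symmetric e) (e_irr : irreflexive e).
Hypothesis acyc : forall c : seq T, (2 < size c)%N -> ~ ucycle e c.

Definition root_paths (p : T -> seq T) : Prop :=
  forall v, [/\ path e o (p v), uniq (o :: p v) & last o (p v) = v].

Lemma root_paths_exist :
  (forall x y, connect e x y) -> exists p, root_paths p.
Proof.
move=> conn; apply: (@fin_all_exists T (fun=> seq T)
  (fun v q => [/\ path e o q, uniq (o :: q) & last o q = v])) => v.
by have /connectP[q0 /shortenP[q eq uq _] ->] := conn o v; exists q.
Qed.

Variable p : T -> seq T.
Hypothesis p_root : root_paths p.

(** Descendants, through the prefix order on root paths: its antisymmetry and
    the comparability of two prefixes of one word give those of ancestors. *)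
Definition below (x : T) : {set T} := [set v | prefix (p x) (p v)].

Lemma root_path_unique q : path e o q -> uniq (o :: q) -> q = p (last o q).
Proof.
move=> eq uq; have [ep up lp] := p_root (last o q).
by apply: (acyclic_path_unique e_sym acyc eq ep uq up); rewrite lp.
Qed.

Lemma root_path_inj : injective p.
Proof.
by move=> x y eq_p; have [_ _ <-] := p_root x; rewrite eq_p; case: (p_root y).
Qed.

Lemma root_path0 : p o = [::].
Proof. by apply: esym; apply: (@root_path_unique [::]). Qed.

Lemma prefix_root_path x q :
  path e o q -> uniq (o :: q) -> x \in o :: q -> prefix (p x) q.
Proof.
move=> eq uq; rewrite inE => /predU1P[-> | xq].
  by rewrite root_path0 prefix0s.
case/splitPr: xq eq uq => s t; rewrite -cat_rcons -cat_cons cat_uniq cat_path.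
case/andP=> es _ /andP[us _].
by rewrite (root_path_unique es us) last_rcons prefix_prefix.
Qed.

Lemma root_path_edge x y :
  e x y -> p y = rcons (p x) y \/ p x = rcons (p y) x.
Proof.
suff step u v : e u v -> v \notin o :: p u -> p v = rcons (p u) v.
  move=> exy; have [ypx | ] := boolP (y \in o :: p x); last first.
    by left; apply: step.
  right; apply: step; first by rewrite e_sym.
  apply/negP=> xpy; have [ex ux lx] := p_root x; have [ey uy ly] := p_root y.
  have pyx := prefix_root_path ex ux ypx.
  have pxy := prefix_root_path ey uy xpy.
  have /eqP : p x == p y.
    by rewrite prefixE in pxy; rewrite -(eqP pxy) take_oversize // size_prefix.
  by move/root_path_inj=> xy; rewrite xy e_irr in exy.
move=> euv vNpu; have [eu uu lu] := p_root u.
have := @root_path_unique (rcons (p u) v).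
rewrite last_rcons => <- //; first by rewrite rcons_path eu lu.
by rewrite -rcons_cons rcons_uniq vNpu.
Qed.

Lemma root_path_parent v :
  v != o -> exists2 u, e u v & p v = rcons (p u) v.
Proof.
have [ev uv lv] := p_root v.
case: (lastP (p v)) ev uv lv => [|q w] ev uv lv; first by rewrite -lv eqxx.
rewrite last_rcons in lv; rewrite lv rcons_path in ev uv *.
move=> _; case/andP: ev => eq eqv; exists (last o q) => //.
rewrite -root_path_unique //.
by move: uv; rewrite -rcons_cons rcons_uniq; case/andP.
Qed.

Lemma below_refl x : x \in below x.
Proof. by rewrite inE prefix_refl. Qed.

Lemma below_anti x y : y \in below x -> x \in below y -> x = y.
Proof.
rewrite !inE => pxy pyx; apply: root_path_inj.
have := pxy; rewrite prefixE => /eqP <-.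
by rewrite take_oversize // size_prefix.
Qed.

Lemma below_trans x y : y \in below x -> below y \subset below x.
Proof.
rewrite inE => pxy; apply/subsetP=> v; rewrite !inE; exact: prefix_trans.
Qed.

Lemma below_inj : injective below.
Proof.
move=> x y eq_xy; apply: below_anti; first by rewrite eq_xy below_refl.
by rewrite -eq_xy below_refl.
Qed.

Lemma mem_below_root v : v \in below o.
Proof. by rewrite inE root_path0 prefix0s. Qed.

Lemma root_below x : x != o -> o \notin below x.
Proof.
by apply: contraNN => ox; rewrite (below_anti ox (mem_below_root x)).
Qed.

Lemma below_chain m x y : m \in below x -> m \in below y ->
  below x \subset below y \/ below y \subset below x.
Proof.
rewrite !inE !prefixE => /eqP mx /eqP my.
have [le_xy | /ltnW le_yx] := leqP (size (p x)) (size (p y)).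
  by right; apply: below_trans; rewrite inE prefixE -my take_takel // mx.
by left; apply: below_trans; rewrite inE prefixE -mx take_takel // my.
Qed.

(** Walking along an edge changes the root path by its lower end only. *)
Lemma cut_tree_edge x y z :
  p y = rcons (p z) y -> ((y \in below x) != (z \in below x)) = (x == y).
Proof.
move=> py; rewrite !inE.
have -> : prefix (p x) (p y) = (p x == p y) || prefix (p x) (p z).
  rewrite py; apply/idP/orP=> [|[/eqP-> | ]]; last 1 first.
  - by move=> pxz; apply: prefix_trans pxz (prefix_rcons _ _).
  - case/prefixP=> s; case: (lastP s) => [|t a].
      by rewrite cats0 => ->; left.
    rewrite -rcons_cat => /rcons_inj[-> _]; right; exact: prefix_prefix.
  exact: prefix_refl.
rewrite (inj_eq root_path_inj).
have [-> | _] := eqVneq x y; last by rewrite eqxx.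
have -> // : prefix (p y) (p z) = false.
by apply/negP=> /size_prefix; rewrite py size_rcons ltnn.
Qed.

(** A pair of nodes [y], [z] is separated by [below x] for as many [x] as
    there are edges on the tree path between them. *)
Lemma edge_of_cuts y z : y != z ->
    (forall x x', (y \in below x) != (z \in below x) ->
       (y \in below x') != (z \in below x') -> x = x') ->
  e y z.
Proof.
suff step u v : u != v -> v \notin below u ->
    (forall x x', (u \in below x) != (v \in below x) ->
       (u \in below x') != (v \in below x') -> x = x') -> e u v.
  move=> yz cuts; have [zy | ] := boolP (z \in below y); last first.
    by move=> zNy; apply: step.
  rewrite e_sym; apply: step; first by rewrite eq_sym.
    by apply: contra yz => yBz; rewrite (below_anti zy yBz).
  by move=> x x' cx cx'; apply: cuts; rewrite eq_sym.
move=> uv vNu cuts.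
have uo : u != o by apply: contraNneq vNu => ->; apply: mem_below_root.
have [w ewu pu] := root_path_parent uo.
have cut_u : (u \in below u) != (v \in below u).
  by rewrite below_refl (negPf vNu).
have not_cut x : x != u -> (u \in below x) = (v \in below x).
  move=> xu; apply/eqP; apply/negPn/negP=> cx.
  by move: xu; rewrite (cuts _ _ cx cut_u) eqxx.
have uw x : x != u -> (u \in below x) = (w \in below x).
  by move=> xu; apply/eqP; rewrite -[_ == _]negbK (cut_tree_edge _ pu).
have wu : w != u by apply: contraTneq ewu => ->; rewrite e_irr.
(* Apart from [below u], the same sets contain [u], [v] and the parent [w]. *)
have vw : v = w.
  apply: below_anti.
    by rewrite -uw 1?eq_sym // not_cut 1?eq_sym // below_refl.
  by rewrite -not_cut // uw // below_refl.
by rewrite vw e_sym.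
Qed.

(** A deepest node below [x] has no further descendant. *)
Lemma below_leaf x : exists2 n, n \in below x &
  forall q, path e o q -> uniq (o :: q) -> n \in o :: q -> last o q = n.
Proof.
have [n nx n_max] := arg_maxnP (fun v => size (p v)) (below_refl x).
exists n => // q eq uq nq.
have pq := root_path_unique eq uq; have := prefix_root_path eq uq nq.
rewrite {1}pq => npre; apply: root_path_inj; apply/eqP.
have := npre; rewrite prefixE take_oversize //.
by apply: n_max; apply: (subsetP (below_trans nx)); rewrite inE.
Qed.

End RootedTree.

(** * The weighted Laplacian as an energy form *)

Section Laplacian.

Variables (R : realFieldType) (N L : nat) (E : lines N L).
Variables (r : 'rV[R]_L) (r_gt0 : forall l, 0 < r 0 l).

(** Grounding potentials at the root turns the reduced incidence matrix into
    plain differences between the ends of a line. *)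
Definition pot (x : 'cV[R]_N) (v : 'I_N.+1) : R :=
  oapp (fun n => x n 0) 0 (unlift ord0 v).

Definition line_drop (x : 'cV[R]_N) (l : 'I_L) : R :=
  pot x (from E l) - pot x (to E l).

Definition ind (S : {set 'I_N.+1}) : 'cV[R]_N :=
  \col_n (lift ord0 n \in S)%:R.

Definition cut (S : {set 'I_N.+1}) (l : 'I_L) : bool :=
  (from E l \in S) != (to E l \in S).

Lemma pot_root x : pot x ord0 = 0.
Proof. by rewrite /pot unlift_none. Qed.

Lemma pot_lift x n : pot x (lift ord0 n) = x n 0.
Proof. by rewrite /pot liftK. Qed.

Lemma pot_ind (S : {set 'I_N.+1}) v :
  ord0 \notin S -> pot (ind S) v = (v \in S)%:R.
Proof.
move=> S0; case: (unliftP ord0 v) => [n -> | ->]; first by rewrite pot_lift mxE.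
by rewrite pot_root (negPf S0).
Qed.

Lemma drop_ind (S : {set 'I_N.+1}) l : ord0 \notin S ->
  line_drop (ind S) l = (from E l \in S)%:R - (to E l \in S)%:R.
Proof. by move=> S0; rewrite /line_drop !pot_ind. Qed.

Lemma sqr_drop_ind (S : {set 'I_N.+1}) l : ord0 \notin S ->
  line_drop (ind S) l ^+ 2 = (cut S l)%:R.
Proof.
move=> S0; rewrite drop_ind // /cut.
by case: (_ \in S); case: (_ \in S); rewrite ?subrr ?subr0 ?sub0r ?sqrrN
  ?expr0n ?expr1n.
Qed.

Lemma incidence_drop x : incidence R E *m x = \col_l line_drop x l.
Proof.
apply/colP=> l; rewrite !mxE /line_drop.
have sum_at v : \sum_n (v == lift ord0 n)%:R * x n 0 = pot x v.
  case: (unliftP ord0 v) => [k -> | ->].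
    rewrite pot_lift (bigD1 k) //= eqxx mul1r big1 ?addr0 // => n nk.
    by rewrite (inj_eq lift_inj) eq_sym (negPf nk) mul0r.
  by rewrite pot_root big1 // => n _; rewrite (negPf (neq_lift _ _)) mul0r.
rewrite -!sum_at -sumrB; apply: eq_bigr => n _.
by rewrite mxE mulrBl.
Qed.

Lemma invmx_diag_resistance : invmx (diag_mx r) = diag_mx (\row_l (r 0 l)^-1).
Proof.
have r1 : diag_mx r *m diag_mx (\row_l (r 0 l)^-1) = 1%:M.
  rewrite mulmx_diag -diag_const_mx; congr diag_mx; apply/rowP=> l.
  by rewrite !mxE divff // gt_eqF.
have [ru _] := mulmx1_unit r1.
by rewrite -[LHS]mulmx1 -r1 mulKmx.
Qed.

Lemma Theta_form b (y x : 'cV[R]_N) :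
  (y^T *m Theta E r b *m x) 0 0 =
    \sum_l (b l)%:R / r 0 l * (line_drop y l * line_drop x l).
Proof.
rewrite /Theta invmx_diag_resistance !mulmxA -mulmxA incidence_drop.
rewrite -trmx_mul incidence_drop -[_ *m diag_mx _ *m diag_mx _]mulmxA.
rewrite mulmx_diag mul_mx_diag !mxE; apply: eq_bigr => l _.
by rewrite !mxE mulrAC mulrC -!mulrA; congr (_ * (_ * _)); rewrite mulrC.
Qed.

Lemma Theta_sym b : (Theta E r b)^T = Theta E r b.
Proof.
rewrite /Theta invmx_diag_resistance !trmx_mul trmxK !tr_diag_mx !mulmxA.
by rewrite -[_ *m diag_mx _ *m diag_mx _]mulmxA diag_mxC !mulmxA.
Qed.

(** Otherwise the indicator of [S] has no energy. *)
Lemma posdef_cut b (S : {set 'I_N.+1}) : posdef (Theta E r b) ->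
  ord0 \notin S -> S != set0 -> exists2 l, b l & cut S l.
Proof.
move=> [_ pos] S0 /set0Pn[v vS].
have [/existsP[l /andP[bl cl]] | none] := boolP [exists l, b l && cut S l].
  by exists l.
have indN0 : ind S != 0.
  apply: contraTneq vS => ind0; have := pot_ind v S0.
  rewrite ind0 /pot; case: unlift => [n|] /=; rewrite ?mxE => /eqP;
  by rewrite eq_sym pnatr_eq0 eqb0.
have := pos _ indN0; rewrite Theta_form big1 ?ltxx // => l _.
rewrite -expr2 sqr_drop_ind //.
move: none; rewrite negb_exists => /forallP/(_ l).
by rewrite negb_and; case: (b l) => /= [/negPf -> | _]; rewrite ?mulr0 ?mul0r.
Qed.

(** * Unit flows in a network with as many lines as non-root nodes *)

Section Feasible.

Variable b : status L.
Hypothesis b_feas : feasible E r b.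

Lemma energized_enum : exists f : 'I_N -> 'I_L,
  injective f /\ forall l, b l = (l \in codom f).
Proof.
have card_b : #|[set l | b l]| = N.
  rewrite -[RHS](proj1 b_feas) -sum1_card big_mkcond /=.
  by apply: eq_bigr => l _; rewrite inE; case: (b l).
exists (fun i => enum_val (cast_ord (esym card_b) i)); split.
  by move=> i j /enum_val_inj /cast_ord_inj.
move=> l; apply/idP/codomP=> [bl | [i ->]]; last first.
  by have := enum_valP (cast_ord (esym card_b) i); rewrite inE.
have lb : l \in [set l | b l] by rewrite inE.
exists (cast_ord card_b (enum_rank_in lb l)).
by rewrite cast_ordK enum_rankK_in.
Qed.

(** The energized rows of the incidence matrix form a square matrix, injective
    because a potential with no energized drop has no energy. *)
Lemma line_potential l0 : exists h : 'cV[R]_N,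
  forall l, b l -> line_drop h l = (l == l0)%:R.
Proof.
have [f [f_inj bE]] := energized_enum.
pose M := rowsub f (incidence R E).
have M_drop x i : (M *m x) i 0 = line_drop x (f i).
  have <- : (incidence R E *m x) (f i) 0 = line_drop x (f i).
    by rewrite incidence_drop mxE.
  by rewrite !mxE; apply: eq_bigr => n _; rewrite !mxE.
have Mu : M \in unitmx.
  rewrite -unitmx_tr unitmxE unitfE; apply/det0P=> -[v v0 vM].
  have Mv : M *m v^T = 0 by apply: trmx_inj; rewrite trmx_mul trmxK trmx0.
  have vT0 : v^T != 0 by rewrite (can2_eq trmxK trmxK) trmx0.
  have := proj2 (proj2 b_feas) _ vT0; rewrite Theta_form big1 ?ltxx // => l _.
  have [bl | _] := boolP (b l); last by rewrite !mul0r.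
  move: bl; rewrite bE => /codomP[i ->].
  by rewrite -M_drop Mv mxE !mulr0.
exists (invmx M *m \col_i (f i == l0)%:R) => l.
by rewrite bE => /codomP[i ->]; rewrite -M_drop mulKVmx // mxE.
Qed.

(** A level set of [h] at a nonzero value is cut by [l0], the only energized line
    along which [h] varies; so [h] takes a single nonzero value, which is the
    drop along [l0] up to sign. *)
Lemma line_potential_values l0 (h : 'cV[R]_N) :
    (forall l, b l -> line_drop h l = (l == l0)%:R) ->
  forall v, exists c : bool, `|pot h v| = c%:R.
Proof.
move=> hE v; have [h0 | hN0] := eqVneq (pot h v) 0.
  by exists false; rewrite h0 normr0.
have cut_l0 (P : pred R) : P (pot h v) -> ~~ P 0 ->
    P (pot h (from E l0)) != P (pot h (to E l0)) /\ b l0.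
  move=> Pv P0.
  have [||l bl] := posdef_cut (S := [set w | P (pot h w)]) (proj2 b_feas).
  - by rewrite inE pot_root.
  - by apply/set0Pn; exists v; rewrite inE.
  rewrite /cut !inE => cl; suff <- : l = l0 by [].
  apply/eqP; rewrite -[_ == _]negbK; apply/negP=> ll0.
  have := hE l bl; rewrite (negPf ll0) => /eqP; rewrite subr_eq0 => /eqP eq_h.
  by rewrite eq_h eqxx in cl.
(* The drop along [l0] has one end at the value of [v] and one at 0. *)
have [cv bl0] := cut_l0 (pred1 (pot h v)) (eqxx _) ltac:(by rewrite /= eq_sym).
have [c0 _] := cut_l0 (predC1 0) hN0 ltac:(by rewrite /= eqxx).
have := hE l0 bl0; rewrite eqxx /line_drop; exists true.
move: cv c0 H => /=.
have [-> | _] := eqVneq (pot h (from E l0)) (pot h v).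
  rewrite hN0 => _; have [-> | //] := eqVneq (pot h (to E l0)) 0.
  by rewrite subr0 => _ ->; rewrite normr1.
have [-> | //] := eqVneq (pot h (to E l0)) (pot h v).
rewrite hN0 => _; have [-> | //] := eqVneq (pot h (from E l0)) 0.
by rewrite sub0r => _ /(congr1 Num.norm); rewrite normrN normr1.
Qed.

Variables (m : 'I_N) (u : 'cV[R]_N).
Hypothesis u_inj : Theta E r b *m u = delta_mx m 0.

Lemma form_injection y : (y^T *m Theta E r b *m u) 0 0 = pot y (lift ord0 m).
Proof. by rewrite -mulmxA u_inj -colE pot_lift !mxE. Qed.

(** The flow on [l] is the value at the injection node of the potential that
    varies along [l] only, by symmetry of the energy form. *)
Lemma unit_flow l : b l -> exists c : bool, `|line_drop u l / r 0 l| = c%:R.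
Proof.
move=> bl; have [h hE] := line_potential l.
have [c hc] := line_potential_values hE (lift ord0 m); exists c.
rewrite -hc -form_injection Theta_form (bigD1 l) //= hE // eqxx bl big1.
  by rewrite addr0 !mul1r mulrC.
move=> k kl; have [bk | _] := boolP (b k); last by rewrite !mul0r.
by rewrite hE // (negPf kl) mul0r mulr0.
Qed.

(** The unit of current leaving [S] is the sum of positive flows, each of which
    is a whole unit. *)
Lemma downhill_cut_unique (S : {set 'I_N.+1}) :
    ord0 \notin S -> lift ord0 m \in S ->
    (forall v w, v \in S -> w \notin S -> pot u w < pot u v) ->
  forall l1 l2, b l1 -> b l2 -> cut S l1 -> cut S l2 -> l1 = l2.
Proof.
move=> S0 mS downhill l1 l2 b1 b2 c1 c2; apply/eqP/negPn/negP=> l12.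
(* outward flow on [l] if it leaves [S], and 0 otherwise *)
pose F l := (b l)%:R / r 0 l * (line_drop (ind S) l * line_drop u l).
have F_abs l : cut S l ->
    F l = (b l)%:R * `|line_drop u l / r 0 l| /\ line_drop u l != 0.
  rewrite /cut /F drop_ind // -mulrA => cl.
  suff [-> ->] : ((from E l \in S)%:R - (to E l \in S)%:R) * line_drop u l
      = `|line_drop u l| /\ line_drop u l != 0.
    by rewrite normrM normfV (gtr0_norm (r_gt0 l)) [_^-1 * _]mulrC.
  move: cl; rewrite /line_drop; have [fS | fS] := boolP (from E l \in S);
    have [tS | tS] := boolP (to E l \in S) => // _.
    have du := downhill _ _ fS tS.
    by rewrite subr0 mul1r gtr0_norm ?subr_gt0 // subr_eq0 gt_eqF.
  have du := downhill _ _ tS fS.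
  by rewrite sub0r mulN1r ltr0_norm ?subr_lt0 // subr_eq0 lt_eqF.
have F1 l : b l -> cut S l -> F l = 1.
  move=> bl cl; have [-> du] := F_abs l cl; rewrite bl mul1r.
  have [[-> // | /eqP]] := unit_flow bl.
  by rewrite normr_eq0 mulf_eq0 invr_eq0 (negPf du) gt_eqF.
have F_ge0 l : 0 <= F l.
  have [/F_abs[-> _] | ] := boolP (cut S l); first by rewrite mulr_ge0 ?ler0n.
  by rewrite /F drop_ind // /cut negbK => /eqP->; rewrite subrr mul0r mulr0.
have : pot (ind S) (lift ord0 m) = 1 by rewrite pot_ind // mS.
rewrite -form_injection Theta_form -/F (bigD1 l1) //= (bigD1 l2) 1?eq_sym //=.
rewrite -!/(F _) !F1 // addrA => /eqP; rewrite gt_eqF // ltr_wpDr //.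
  by apply: sumr_ge0 => l _; apply: F_ge0.
by rewrite ltrDl.
Qed.

(** An energized line in both cuts is the only one in either, so no energized
    line leaves the symmetric difference. *)
Lemma shared_cut (S S' : {set 'I_N.+1}) l0 :
    ord0 \notin S -> ord0 \notin S' -> b l0 -> cut S l0 -> cut S' l0 ->
    (forall l, b l -> cut S l -> l = l0) ->
    (forall l, b l -> cut S' l -> l = l0) ->
  S = S'.
Proof.
move=> S0 S'0 b0 c0 c0' uniqS uniqS'.
pose D := [set v | (v \in S) (+) (v \in S')].
have [D0 | D0] := eqVneq D set0.
  apply/setP=> v; have : v \in D = false by rewrite D0 inE.
  by rewrite inE; case: (v \in S); case: (v \in S').
have [|l bl] := posdef_cut (proj2 b_feas) _ D0.
  by rewrite inE (negPf S0) (negPf S'0).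
have -> : cut D l = cut S l (+) cut S' l.
  by rewrite /cut !inE; do 4 case: (_ \in _).
case cl : (cut S l); case cl' : (cut S' l) => //= _.
  by rewrite (uniqS l bl cl) c0' in cl'.
by rewrite (uniqS' l bl cl') c0 in cl.
Qed.

End Feasible.

(** * The Laplacian of a tree from its fundamental cuts *)

Section FundamentalCuts.

Variables (b : status L) (line : 'I_N -> 'I_L) (D : 'I_N -> {set 'I_N.+1}).
Hypotheses (line_inj : injective line).
Hypotheses (bE : forall l, b l = (l \in codom line)).
Hypothesis D0 : forall n, ord0 \notin D n.
Hypothesis cut_line : forall n k, cut (D k) (line n) = (k == n).

Definition cutmx : 'M[R]_N := \matrix_(n, k) (lift ord0 k \in D n)%:R.

Definition line_resistance : 'rV[R]_N := \row_n r 0 (line n).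

Lemma row_cutmx n : row n cutmx = (ind (D n))^T.
Proof. by apply/rowP=> k; rewrite !mxE. Qed.

(** Each line lies in a single fundamental cut, so the indicators of the [D n]
    are orthogonal for the energy form. *)
Lemma cutmx_Theta :
  cutmx *m Theta E r b *m cutmx^T =
    diag_mx (\row_n (line_resistance 0 n)^-1).
Proof.
apply/matrixP=> n k.
have -> : (cutmx *m Theta E r b *m cutmx^T) n k =
    ((ind (D n))^T *m Theta E r b *m ind (D k)) 0 0.
  rewrite -row_cutmx -[ind (D k)]trmxK -row_cutmx tr_row -row_mul.
  rewrite [LHS]mxE [RHS]mxE; apply: eq_bigr => j _.
  by rewrite [row _ _ _ _]mxE [col _ _ _ _]mxE.
rewrite Theta_form !mxE; have [<- | nk] := eqVneq n k.
  rewrite mulr1n (bigD1 (line n)) //= -expr2 sqr_drop_ind //.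
  rewrite cut_line eqxx mulr1.
  rewrite bE codom_f mul1r big1 ?addr0 // => l ln.
  have [| _] := boolP (b l); last by rewrite !mul0r.
  rewrite bE => /codomP[j lj]; rewrite -expr2 sqr_drop_ind // lj cut_line.
  by have [nj | _] := eqVneq n j; [rewrite lj nj eqxx in ln | rewrite mulr0].
rewrite mulr0n big1 // => l _.
have [| _] := boolP (b l); last by rewrite !mul0r.
rewrite bE => /codomP[j ->].
suff -> : line_drop (ind (D n)) (line j) * line_drop (ind (D k)) (line j) = 0.
  by rewrite mulr0.
apply/eqP; rewrite mulf_eq0 -![line_drop _ _ == 0]sqrf_eq0 !sqr_drop_ind //.
rewrite !cut_line !pnatr_eq0 !eqb0 -negb_and.
by apply/andP=> -[/eqP nj /eqP kj]; rewrite nj kj eqxx in nk.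
Qed.

Lemma line_resistance_inv :
  diag_mx (\row_n (line_resistance 0 n)^-1) *m diag_mx line_resistance = 1%:M.
Proof.
rewrite mulmx_diag -diag_const_mx; congr diag_mx; apply/rowP=> n.
by rewrite !mxE mulVf // gt_eqF.
Qed.

Lemma Theta_fundamental_inv :
  Theta E r b *m (cutmx^T *m diag_mx line_resistance *m cutmx) = 1%:M.
Proof.
have cut_inv :
    cutmx *m (Theta E r b *m cutmx^T *m diag_mx line_resistance) = 1%:M.
  by rewrite mulmxA [cutmx *m _]mulmxA cutmx_Theta line_resistance_inv.
by have := mulmx1C cut_inv; rewrite -!(mulmxA (Theta E r b)).
Qed.

Lemma Theta_fundamental_unit : Theta E r b \in unitmx.
Proof. by have [] := mulmx1_unit Theta_fundamental_inv. Qed.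

Lemma Rmx_fundamental :
  Rmx E r b = cutmx^T *m diag_mx line_resistance *m cutmx.
Proof.
by rewrite -[RHS](mulKmx Theta_fundamental_unit) Theta_fundamental_inv mulmx1.
Qed.

Lemma pot_Rmx m v : pot (Rmx E r b *m delta_mx m 0) v =
  \sum_n r 0 (line n) * ((lift ord0 m \in D n)%:R * (v \in D n)%:R).
Proof.
rewrite Rmx_fundamental -colE; case: (unliftP ord0 v) => [k -> | ->].
  rewrite pot_lift mul_mx_diag !mxE; apply: eq_bigr => n _.
  by rewrite !mxE [_ * r 0 _]mulrC -mulrA; congr (_ * _); rewrite mulrC.
by rewrite pot_root big1 // => n _; rewrite (negPf (D0 n)) !mulr0.
Qed.

Lemma fundamental_feasible : feasible E r b.
Proof.
split.
  transitivity #|codom line|; last by rewrite card_codom // card_ord.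
  rewrite -sum1_card [RHS]big_mkcond /=.
  by apply: eq_bigr => l _; rewrite bE; case: (_ \in _).
split=> [|x x0]; first exact: Theta_sym.
have term_ge0 l : true ->
    0 <= (b l)%:R / r 0 l * (line_drop x l * line_drop x l).
  by move=> _; rewrite -expr2 mulr_ge0 ?sqr_ge0 // divr_ge0 ?ler0n ?ltW.
rewrite lt_neqAle Theta_form sumr_ge0 // andbT eq_sym.
apply: contraNneq x0 => energy0.
suff Tx0 : Theta E r b *m x = 0.
  by rewrite -[x](mulKmx Theta_fundamental_unit) Tx0 mulmx0.
have drop0 l : (b l)%:R * line_drop x l = 0.
  have /eqP := psumr_eq0P term_ge0 energy0 (i := l) isT.
  have := r_gt0 l; rewrite lt0r => /andP[rl _].
  rewrite !mulf_eq0 invr_eq0 (negPf rl) orbF orbb.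
  by case/orP=> /eqP->; rewrite ?mulr0 ?mul0r.
apply/colP=> n; have := Theta_form b (delta_mx n 0) x.
rewrite trmx_delta -(mulmxA _ (Theta E r b)) -rowE [row _ _ _ _]mxE => ->.
rewrite mxE; apply: big1 => l _.
by rewrite [_ * line_drop x l]mulrC mulrACA drop0 mul0r.
Qed.

End FundamentalCuts.

End Laplacian.

(** * The energized lines of a tree *)

Lemma adj_sym (N L : nat) (E : lines N L) b : symmetric (adj E b).
Proof.
move=> x y; rewrite /adj /=.
by apply: eq_existsb => l; congr (_ && (_ == _)); rewrite setUC.
Qed.

Lemma adj_irr (N L : nat) (E : lines N L) b : irreflexive (adj E b).
Proof.
move=> x; apply/negbTE; rewrite negb_exists; apply/forallP=> l.
rewrite negb_and; apply/orP; right; apply: contra (no_loop E l) => /eqP xx.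
have : from E l \in [set x; x] by rewrite -xx set21.
have : to E l \in [set x; x] by rewrite -xx set22.
by rewrite setUid !inE => /eqP-> /eqP->.
Qed.

Section TreeLines.

Variables (N L : nat) (E : lines N L) (b : status L).
Hypothesis b_tree : is_tree E b.
Variable p : 'I_N.+1 -> seq 'I_N.+1.
Hypothesis p_root : root_paths (adj E b) ord0 p.

Let D (n : 'I_N) : {set 'I_N.+1} := below p (lift ord0 n).

Let adjS : symmetric (adj E b) := @adj_sym N L E b.
Let acyc := proj2 b_tree.

Lemma below_nonroot n : ord0 \notin D n.
Proof. by apply: (root_below adjS acyc p_root); rewrite eq_sym neq_lift. Qed.

(** The node [n] is the lower end of the line: it is the only one whose root
    path uses the line as its last step. *)
Lemma line_lower_end l : b l -> exists u n,
  [/\ [set from E l; to E l] = [set u; lift ord0 n],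
      p (lift ord0 n) = rcons (p u) (lift ord0 n)
    & forall k, cut E (D k) l = (k == n)].
Proof.
move=> bl.
have cutE x y : p x = rcons (p y) x -> exists2 n, x = lift ord0 n &
    forall k, ((x \in D k) != (y \in D k)) = (k == n).
  case: (unliftP ord0 x) => [n -> | ->] px; last first.
    move: px; rewrite (root_path0 adjS acyc p_root).
    by move/(congr1 size); rewrite size_rcons.
  exists n => // k; rewrite (cut_tree_edge p_root _ px).
  exact: (inj_eq lift_inj).
have e_l : adj E b (from E l) (to E l).
  by apply/existsP; exists l; rewrite bl /=.
case: (root_path_edge adjS (@adj_irr _ _ E b) acyc p_root e_l) => pxy;
  have [n xn cn] := cutE _ _ pxy.
- by exists (from E l), n; rewrite -xn; split=> // k; rewrite /cut eq_sym.
- by exists (to E l), n; rewrite -xn; split=> //; rewrite setUC.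
Qed.

(** Lines and non-root nodes correspond by the lower end, the line of [n]
    joining it to its parent and being the only tree line that leaves [D n]. *)
Lemma tree_lines : exists line : 'I_N -> 'I_L,
  [/\ injective line, forall l, b l = (l \in codom line)
    & forall n k, cut E (D k) (line n) = (k == n)].
Proof.
have line_above n : exists l, b l /\ cut E (D n) l.
  have n0 : lift ord0 n != ord0 by rewrite eq_sym neq_lift.
  have [u /existsP[l /andP[bl /eqP ul]] pn] :=
    root_path_parent adjS acyc p_root n0.
  exists l; split=> //; have [w [k [wk pk ->]]] := line_lower_end bl.
  have : lift ord0 n \in [set w; lift ord0 k] by rewrite -wk ul set22.
  rewrite !inE (inj_eq lift_inj) => /predU1P[nw | //].
  have : lift ord0 k \in [set u; lift ord0 n] by rewrite -ul wk set22.
  rewrite !inE (inj_eq lift_inj) [k == n]eq_sym => /predU1P[ku | //].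
  (* Otherwise each end of the line would be the parent of the other. *)
  move: pk; rewrite -nw pn ku => /(congr1 size); rewrite !size_rcons => /eqP.
  by rewrite -[_.+2]addn2 -[X in X == _]addn0 eqn_add2l.
have [line lineP] := fin_all_exists line_above.
have line_cut n k : cut E (D k) (line n) = (k == n).
  have [bl cl] := lineP n; have [_ [j [_ _ cutE]]] := line_lower_end bl.
  by move: cl; rewrite !cutE => /eqP->.
exists line; split=> // [n k eq_l | l].
  by have := line_cut n k; rewrite eq_l line_cut eqxx => /esym/eqP.
apply/idP/codomP=> [bl | [n ->]]; last by case: (lineP n).
have [u [n [un pn cutE]]] := line_lower_end bl; exists n.
have [bn cn] := lineP n; have [w [k [wk pk cutE']]] := line_lower_end bn.
move: cn; rewrite cutE' => /eqP nk; rewrite -nk in wk pk.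
apply: (@no_parallel _ _ E); rewrite /= un wk; congr [set _; _].
by move: pk; rewrite pn => /rcons_inj[/(root_path_inj p_root) ->].
Qed.

End TreeLines.

(** * Identification of the topology *)

Section Identify.

Variables (R : realFieldType) (N L : nat) (E : lines N L).
Variables (r : 'rV[R]_L) (r_gt0 : forall l, 0 < r 0 l).
Variables (bo : status L) (bo_tree : is_tree E bo).

Let adjS : symmetric (adj E bo) := @adj_sym N L E bo.
Let acyc := proj2 bo_tree.

Lemma tree_feasible : feasible E r bo /\ Theta E r bo \in unitmx.
Proof.
have [p p_root] := root_paths_exist ord0 (proj1 bo_tree).
have [line [line_inj boE cutE]] := tree_lines bo_tree p_root.
have D0 := below_nonroot bo_tree p_root.
split; first exact: (fundamental_feasible r_gt0 line_inj boE D0 cutE).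
exact: (Theta_fundamental_unit r_gt0 boE D0 cutE).
Qed.

(** For [m] below [x] the potential is a sum over the ancestors [n] of [m] of
    positive multiples of the indicator of the nodes below [n]; the ancestors
    of [m] form a chain, so every such indicator is at least as large inside
    [below p x] as outside, and the one of [x] itself is larger. *)
Lemma tree_downhill p x m :
    root_paths (adj E bo) ord0 p -> x != ord0 -> lift ord0 m \in below p x ->
  forall v w, v \in below p x -> w \notin below p x ->
  pot (Rmx E r bo *m delta_mx m 0) w < pot (Rmx E r bo *m delta_mx m 0) v.
Proof.
move=> p_root x0 mx v w vx wx.
have [line [_ boE cutE]] := tree_lines bo_tree p_root.
have D0 := below_nonroot bo_tree p_root.
rewrite !(pot_Rmx r_gt0 boE D0 cutE).
have [k xk] : exists k, x = lift ord0 k.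
  by case: (unliftP ord0 x) x0 => [k -> | ->]; [exists k | rewrite eqxx].
subst x.
rewrite (bigD1 k) //= [ltRHS](bigD1 k) //= ltr_leD //.
  by rewrite mx vx (negPf wx) !mulr0 !mulr1 r_gt0.
apply: ler_sum => n _; rewrite ler_wpM2l ?(ltW (r_gt0 _)) //.
have [mn | _] := boolP (lift ord0 m \in _); last by rewrite !mul0r.
rewrite !mul1r ler_nat; have [wn | //] := boolP (w \in _).
have [nk | /subsetP kn] := below_chain mn mx.
  by rewrite (subsetP nk) in wx.
by rewrite kn.
Qed.

(** A leaf below [x] is probed, and its potential in the tree, which is also a
    unit-injection potential for [b], is higher inside [below p x] than outside:
    one line of [b] leaves [below p x]. Two such sets cannot share that line, so
    a line of [b] lies in one cut at most and joins tree neighbors. Every tree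
    line is used, since [b] has to leave the corresponding set. *)
Lemma probes_identify (C : {set 'I_N}) b :
    (forall n : 'I_N.+1, leaf E bo n -> n \in [set lift ord0 m | m in C]) ->
    feasible E r b ->
    (forall m, m \in C ->
       Theta E r b *m (Rmx E r bo *m delta_mx m 0)
         = delta_mx m 0 :> 'cV[R]_N) ->
  b = bo.
Proof.
move=> leaves b_feas probes.
have [p p_root] := root_paths_exist ord0 (proj1 bo_tree).
have o_below v := mem_below_root adjS acyc p_root v.
have below0 x : x != ord0 -> ord0 \notin below p x.
  exact: (root_below adjS acyc p_root).
have cut_unique x l1 l2 : x != ord0 -> b l1 -> b l2 ->
    cut E (below p x) l1 -> cut E (below p x) l2 -> l1 = l2.
  move=> x0; have [n nx n_leaf] := below_leaf adjS acyc p_root x.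
  have /leaves/imsetP[m mC nm] : leaf E bo n.
    by move=> k [q [eq uq <-] nq]; apply: n_leaf.
  rewrite nm in nx.
  apply: (downhill_cut_unique r_gt0 b_feas (probes m mC)) => //.
    exact: below0.
  exact: tree_downhill.
have b_sub l : b l -> bo l.
  move=> bl; suff /existsP[k /andP[bk /eqP kl]] : adj E bo (from E l) (to E l).
    by rewrite -(no_parallel kl).
  apply: (edge_of_cuts adjS (@adj_irr _ _ E bo) acyc p_root (no_loop E l)).
  have nonroot x : cut E (below p x) l -> x != ord0.
    by apply: contraTneq => ->; rewrite /cut !o_below.
  move=> x x' cx cx'; apply: (below_inj p_root).
  by apply: (shared_cut r_gt0 b_feas (below0 _ (nonroot _ cx))
    (below0 _ (nonroot _ cx')) bl cx cx') => k bk ck;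
    [apply: (cut_unique x) | apply: (cut_unique x')] => //; apply: nonroot.
have [line [_ boE cutE]] := tree_lines bo_tree p_root.
apply/ffunP=> l; apply/idP/idP=> [|bol]; first exact: b_sub.
have := bol; rewrite boE => /codomP[n ln].
have [||k bk ck] :=
  posdef_cut r_gt0 (S := below p (lift ord0 n)) (proj2 b_feas).
- exact: (below_nonroot bo_tree p_root).
- by apply/set0Pn; exists (lift ord0 n); apply: below_refl.
have := b_sub k bk; rewrite boE => /codomP[j kj].
by move: ck bk; rewrite kj cutE ln => /eqP->.
Qed.

End Identify.

(** * The least-squares problem *)

Lemma sqnorm_cols (R : realFieldType) (m n : nat) (W : 'M[R]_m)
    (X : 'M[R]_(m, n)) :
  sqnorm W X = \sum_j ((col j X)^T *m W *m col j X) 0 0.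
Proof.
apply: eq_bigr => j _; rewrite tr_col -row_mul [LHS]mxE [RHS]mxE.
by apply: eq_bigr => k _; rewrite [row _ _ _ _]mxE [col _ _ _ _]mxE.
Qed.

Lemma posdef_ge0 (R : realFieldType) (m : nat) (W : 'M[R]_m) (x : 'cV[R]_m) :
  posdef W -> 0 <= (x^T *m W *m x) 0 0.
Proof.
case=> _ W_pos; have [-> | /W_pos/ltW //] := eqVneq x 0.
by rewrite mulmx0 mxE.
Qed.

Lemma sqnorm_ge0 (R : realFieldType) (m n : nat) (W : 'M[R]_m)
    (X : 'M[R]_(m, n)) : posdef W -> 0 <= sqnorm W X.
Proof.
by move=> hW; rewrite sqnorm_cols sumr_ge0 // => j _; apply: posdef_ge0.
Qed.

Lemma sqnorm_eq0 (R : realFieldType) (m n : nat) (W : 'M[R]_m)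
    (X : 'M[R]_(m, n)) : posdef W -> sqnorm W X = 0 -> X = 0.
Proof.
move=> hW; rewrite sqnorm_cols => X0.
have ge0 j : true -> 0 <= ((col j X)^T *m W *m col j X) 0 0.
  by move=> _; apply: posdef_ge0.
apply/matrixP=> i j; have := psumr_eq0P ge0 X0 (i := j) isT.
have [cX _ | /(proj2 hW)] := eqVneq (col j X) 0; last first.
  by rewrite lt0r => /andP[/eqP].
by have := congr1 (fun M : 'cV[R]_m => M i 0) cX; rewrite !mxE.
Qed.

Lemma sqnorm0 (R : realFieldType) (m n : nat) (W : 'M[R]_m) :
  sqnorm W (0 : 'M[R]_(m, n)) = 0.
Proof. by rewrite /sqnorm mulmx0 mxtrace0. Qed.

Lemma col_selmx (R : realFieldType) (N : nat) (C : {set 'I_N}) (j : 'I_#|C|) :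
  col j (selmx R C) = delta_mx (enum_val j) 0.
Proof. by apply/colP=> n; rewrite !mxE eqxx andbT. Qed.

Theorem corollary2 (R : realFieldType) (N L T : nat) (E : lines N L)
    (r : 'rV[R]_L) (hr : forall l, 0 < r 0 l)
    (W : 'M[R]_N) (hW : posdef W)
    (bo : status L) (hbo : is_tree E bo)
    (C : {set 'I_N}) (Delta : 'M[R]_(#|C|, T)) (hDelta : \rank Delta = #|C|)
    (V : 'M[R]_(N, T)) (hV : V = Rmx E r bo *m selmx R C *m Delta)
    (hleaf : forall n : 'I_N.+1,
       leaf E bo n -> n \in [set lift ord0 m | m in C]) :
  unique (minimizer E r W Delta V) bo.
Proof.
have [bo_feas bo_unit] := tree_feasible hr hbo.
have obj_bo : objective E r W Delta V bo = 0.
  by rewrite /objective hV /Rmx -mulmxA mulKVmx // subrr sqnorm0.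
split=> [|b [b_feas b_min]].
  by split=> // b _; rewrite obj_bo sqnorm_ge0.
(* A minimizer attains the value 0 of [bo], that is, it fits the data exactly;
   [Delta], of full row rank, can then be cancelled. *)
apply/esym/(probes_identify hr hbo hleaf b_feas) => m mC.
have V_fit : Theta E r b *m V = selmx R C *m Delta.
  apply/eqP; rewrite -subr_eq0; apply/eqP/(sqnorm_eq0 hW)/le_anti.
  by rewrite sqnorm_ge0 // andbT -obj_bo b_min.
have fit : Theta E r b *m (Rmx E r bo *m selmx R C) = selmx R C.
  apply: (row_free_inj (A := Delta)); first by rewrite /row_free hDelta.
  by rewrite -V_fit hV -(mulmxA (Theta E r b)).
have := congr1 (mulmx^~ (delta_mx (enum_rank_in mC m) 0 : 'cV_#|C|)) fit.
rewrite -(mulmxA (Theta E r b)) -(mulmxA (Rmx E r bo)).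
by rewrite -[selmx R C *m _]colE col_selmx enum_rankK_in.
Qed.
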